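(* Let $k,r,s,t$ be positive integers with $s\le k$, $s\le t$ and $t\le r$, and let $\mathcal{H}$ be an $n$-vertex $t$-intersecting $r$-graph with $\delta_{r-s}^+(\mathcal{H})>\binom{k-1}{s}$. If $\mathcal{H}$ has the maximum number of edges amongst hypergraphs with these properties (that is, amongst all $n$-vertex $t$-intersecting $r$-graphs $\mathcal{H}'$ with $\delta_{r-s}^+(\mathcal{H}')>\binom{k-1}{s}$), then $\mathcal{H}$ is a $(2k-2s+t,\,k-s+t)$-kernel system if $n$ is sufficiently large in terms of $r$.
   Context: An $r$-graph is a hypergraph $\mathcal{H}$ (identified with its set of edges, on a vertex set $V(\mathcal{H})$) all of whose edges are sets of exactly $r$ vertices; it is $n$-vertex if $|V(\mathcal{H})|=n$. It is $t$-intersecting if $|h\cap h'|\ge t$ for any two distinct edges $h,h'\in\mathcal{H}$. For an integer $i$, the minimum positive $i$-degree $\delta_i^+(\mathcal{H})$ is the largest integer $m$ such that every set of $i$ vertices contained in at least one edge of $\mathcal{H}$ is contained in at least $m$ edges of $\mathcal{H}$; by convention $\delta_i^+(\mathcal{H})=\infty$ if $\mathcal{H}$ has no edges. Binomial coefficients satisfy $\binom{a}{b}=0$ for integers $0\le a<b$. An $r$-graph $\mathcal{H}$ is an $(a,b)$-kernel system if there exists $X\subseteq V(\mathcal{H})$ with $|X|=a$ such that an $r$-subset $h$ of $V(\mathcal{H})$ is an edge of $\mathcal{H}$ if and only if $|h\cap X|\ge b$ (in particular, it has no edges if $r<b$).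
   Formalization: The kernel-system conclusion is given when 2k−2s+t ≤ n; when 2k−2s+t > n no vertex set X of that size exists (e.g. r=s=t=1, k=n+1, with the empty graph extremal), and the conclusion there is instead that H has no edges. *)

(* Defs.v *)
From mathcomp Require Import all_boot.

Set Implicit Arguments.
Unset Strict Implicit.
Unset Printing Implicit Defensive.

Section Hypergraphs.
Variable V : finType.
Implicit Types (H : {set {set V}}) (S X h : {set V}).

Definition rgraph (r : nat) H : Prop := {in H, forall h, #|h| = r}.

Definition t_intersecting (t : nat) H : Prop :=
  {in H &, forall h h', h != h' -> t <= #|h :&: h'|}.

Definition degree H S : nat := #|[set h in H | S \subset h]|.

Definition pos_degree_ge (i : nat) H (m : nat) : bool :=
  [forall S : {set V}, (#|S| == i) && (0 < degree H S) ==> (m <= degree H S)].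

(* The largest m with [pos_degree_ge i H m], where [None] stands for infinity.
   If no i-set lies in an edge (in particular if H has no edges), then every m
   qualifies; otherwise every qualifying m is at most #|H|, so that the bound
   on the range of the maximum excludes nothing. *)
Definition min_pos_degree (i : nat) H : option nat :=
  if [exists S : {set V}, (#|S| == i) && (0 < degree H S)]
  then Some (\max_(m < #|H|.+1 | pos_degree_ge i H m) m)
  else None.

Definition kernel_system (r a b : nat) H : Prop :=
  exists2 X : {set V}, #|X| = a &
    H = [set h : {set V} | (#|h| == r) && (b <= #|h :&: X|)].

End Hypergraphs.

(* c < d, for d a natural number or infinity ([None]). *)
Definition lt_ext (c : nat) (d : option nat) : bool :=
  if d is Some m then c < m else true.

Definition admissible (n k r s t : nat) (V : finType) (H : {set {set V}}) :
    Prop :=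
  [/\ #|V| = n, rgraph r H, t_intersecting t H
    & lt_ext 'C(k - 1, s) (min_pos_degree (r - s) H)].

Definition extremal (n k r s t : nat) (V : finType) (H : {set {set V}}) :
    Prop :=
  admissible n k r s t H /\
  forall (W : finType) (H' : {set {set W}}),
    admissible n k r s t H' -> #|H'| <= #|H|.

(* Main.v *)
Require Import Defs.
From mathcomp Require Import all_boot order ssralg ssrnum rat zify.

(** Write [m = k - s + t], and call a set meeting every edge of [H] in at least
    [t] vertices a t-cover; the edges themselves are t-covers.

    The degree hypothesis is used only through [exchange_edge]: more than
    C(k-1, s) sets of size s cannot all lie in one set [Y] of fewer than [k]
    vertices, so s vertices of an edge may be traded for s others that are not
    all in [Y].  Trading vertices of an edge inside a t-cover [M] shrinks its
    trace on [M] as long as that trace exceeds [#|M| + s - k]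
    ([small_trace]).  Since the trace never drops below [t], every t-cover has
    at least [m] vertices.  In particular [H] is empty when [r < m], just as
    the kernel systems are.

    A set with fewer than [m] vertices is thus no t-cover: some edge meets it
    in fewer than [t] vertices, and every t-cover containing it has a further
    vertex on that edge.  Branching [m] times over the at most [r] such vertices
    gives at most [r ^ m] sets of size [m], one of which is contained in each
    edge.  Those that are not t-covers, and those that lie only in edges with a
    further vertex in the bounded union [U] of all m-vertex t-covers, contribute
    a lower order number of edges.  The number of edges is therefore governed by
    the family [F] of m-vertex t-covers of the form [h :&: U] with [h] an edge.

    Starting from such an edge [h] with trace [M] on [U], the exchanges lead to
    an edge that meets [M] in exactly [t] vertices and whose part in [U] outside
    [M] has at most [k - s] vertices; that part meets every other m-vertex
    t-cover ([opposite_set]).  Bollobas' set-pair inequality then gives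
    [#|F| <= 'C(m + (k - s), m)], and its equality case says that [F] contains
    all m-subsets of a set [X] with [m + (k - s)] vertices.  If all of them are
    t-covers, each edge meets [X] in at least [m] vertices, so that [H] lies in
    the kernel system of [X]; that system is itself a competitor
    ([kernel_admissible]), whence equality.  If [F] is smaller, the kernel
    system has more edges than [H] for large [n], its leading term being
    ['C(m + (k - s), m)] times the number of r-sets containing an m-set. *)

Set Implicit Arguments.
Unset Strict Implicit.
Unset Printing Implicit Defensive.

(** * The equality case of Bollobas' set-pair inequality *)

Section SetPairs.
Import GRing.Theory Num.Theory Order.TTheory.
Local Open Scope ring_scope.

Variables (V : finType) (p : nat) (F : {set {set V}}) (N : {set V} -> {set V}).
Implicit Types (A P : {set V}).
Hypothesis cardF : {in F, forall A : {set V}, #|A| = p}.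
Hypothesis disjN : {in F, forall A : {set V}, [disjoint A & N A]}.
Hypothesis meetN :
  {in F &, forall A A' : {set V}, A != A' -> ~~ [disjoint A' & N A]}.

(** The probability that, in a random linear order, a given p-set entirely
    precedes a disjoint set of size [b]. *)
Definition pair_weight (b : nat) : rat := ('C(p + b, p)%:R)^-1.

(** The expected number of [A] in [F] that lie in [P] and precede the trace of
    [N A] in a random order of [P].  It is at most 1 because two such [A] would
    contradict the crossing condition [meetN].  Keeping [P] variable permits an
    induction that removes the last point of the order. *)
Definition trace_sum (P : {set V}) : rat :=
  \sum_(A in F | A \subset P) pair_weight #|N A :&: P|.

(** On such a [P] some [A] precedes the trace of [N A] in every order; removing
    a point of [A] would then lose it, so the induction has to stop. *)
Definition exhausted (P : {set V}) : bool :=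
  [exists A in F, (A \subset P) && [disjoint N A & P]].

Lemma pair_weight0 : pair_weight 0 = 1.
Proof. by rewrite /pair_weight addn0 binn invr1. Qed.

Lemma pair_weightS b :
  b.+1%:R * pair_weight b = (p + b.+1)%:R * pair_weight b.+1.
Proof.
have bin_neq0 c : ('C(p + c, p)%:R : rat) != 0.
  by rewrite pnatr_eq0 -lt0n bin_gt0 leq_addr.
apply: (mulIf (bin_neq0 b)); apply: (mulIf (bin_neq0 b.+1)).
rewrite /pair_weight mulfVK // mulrAC mulfVK // -!natrM; congr _%:R.
have := mul_bin_down (p + b.+1) p; rewrite addnS /= => ->.
by congr muln; lia.
Qed.

Lemma trace_sum_exhausted P : exhausted P -> trace_sum P = 1.
Proof.
case/exists_inP=> A FA /andP[sAP dAP].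
rewrite /trace_sum (bigD1 A) ?FA //= big1 ?addr0;
  last move=> A' /andP[/andP[FA' sA'P] neq].
  by move: dAP; rewrite -setI_eq0 => /eqP->; rewrite cards0 pair_weight0.
have := meetN FA FA'; rewrite eq_sym => /(_ neq)/negP[].
by rewrite disjoint_sym (disjointWr sA'P).
Qed.

(** Averaging over the last point [x] of the order: the term of [A] survives
    the removal of [x] exactly when [x] is outside [A], and gains weight when
    [x] is in [N A]. *)
Lemma sum_trace_sumD1 P : ~~ exhausted P ->
  \sum_(x in P) trace_sum (P :\ x) = #|P|%:R * trace_sum P.
Proof.
move=> exP; rewrite /trace_sum mulr_sumr.
rewrite (exchange_big_dep (fun A => (A \in F) && (A \subset P))) /=; last first.
  by move=> x A Px /andP[-> /subset_trans->] //; apply: subD1set.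
apply: eq_bigr => A /andP[FA sAP].
have : #|N A :&: P| != 0%N.
  apply: contra exP; rewrite cards_eq0 setI_eq0 => dAP.
  by apply/exists_inP; exists A; rewrite ?sAP.
case Db: #|N A :&: P| => [|b] // _.
rewrite (eq_bigl [in P :\: A]); last first.
  by move=> x; rewrite /= subsetD1 sAP FA inE andbC.
rewrite (big_setID (N A)) /=.
have NDA : (P :\: A) :&: N A = N A :&: P.
  apply/setP=> x; rewrite !inE andbC; case Nx: (x \in N A) => //=.
  by rewrite (contraTN _ Nx) // => Ax; rewrite (disjointFr (disjN FA)).
rewrite NDA.
rewrite (eq_bigr (fun=> pair_weight b)); last first.
  move=> x /setIP[Nx Px]; congr pair_weight; move: Db.
  by rewrite setIDA (cardsD1 x) inE Nx Px /= add1n => -[].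
rewrite [X in _ + X](eq_bigr (fun=> pair_weight b.+1)); last first.
  move=> x /setDP[_ Nx]; congr pair_weight; rewrite -Db.
  by apply/eq_card=> y; rewrite !inE; case: eqP => // ->; rewrite (negbTE Nx).
rewrite !sumr_const Db -(mulr_natl (pair_weight b)) pair_weightS.
rewrite -(mulr_natl (pair_weight b.+1)) -mulrDl -natrD; congr (_%:R * _).
have dNA : #|(P :\: A) :\: N A| = (#|P| - p - b.+1)%N.
  by rewrite cardsD NDA Db cardsD (setIidPr sAP) (cardF FA).
rewrite dNA.
have : (#|A :|: (N A :&: P)| <= #|P|)%N.
  by apply: subset_leq_card; rewrite subUset sAP subsetIr.
rewrite cardsU Db (cardF FA) setIA.
move: (disjN FA); rewrite -setI_eq0 => /eqP->; rewrite set0I cards0.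
by lia.
Qed.

Lemma trace_sum_le1 P : trace_sum P <= 1.
Proof.
have [n] := ubnP #|P|; elim: n P => // n IHn P; rewrite ltnS => lePn.
have [/trace_sum_exhausted-> //|exP] := boolP (exhausted P).
have [P0|[x0 Px0]] := set_0Vmem P.
  rewrite /trace_sum big1 // => A /andP[FA sAP]; case/negP: exP.
  by apply/exists_inP; exists A => //; rewrite sAP P0 -setI_eq0 setI0 eqxx.
have P_gt0 : 0 < #|P|%:R :> rat by rewrite ltr0n (cardsD1 x0) Px0.
rewrite -(ler_pM2l P_gt0) mulr1 -sum_trace_sumD1 // -[leRHS]sumr_const.
apply: ler_sum => x Px; apply: IHn.
by move: lePn; rewrite (cardsD1 x) Px.
Qed.

(** Equality for [P] makes the average of the bounds for the sets [P :\ x]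
    tight, hence each of them. *)
Lemma trace_sum_eq1D1 P x :
  ~~ exhausted P -> x \in P -> trace_sum P = 1 -> trace_sum (P :\ x) = 1.
Proof.
move=> exP Px P1; have := sum_trace_sumD1 exP.
rewrite P1 mulr1 -[RHS]sumr_const.
move/eqP; rewrite eq_sym -subr_eq0 -sumrB psumr_eq0; last first.
  by move=> y _; rewrite subr_ge0 trace_sum_le1.
by move/allP/(_ x (mem_index_enum _)); rewrite Px /= subr_eq0 => /eqP.
Qed.

Hypothesis trace_sumT : trace_sum [set: V] = 1.

(** Consider an order in which [A :\ x], then [y], then [x] come first.  By
    tightness some member of [F] precedes its partner in it, and the crossing
    condition with [A] leaves [y |: A :\ x] as the only candidate.  In terms of
    traces, equality descends from the whole type to [(y |: A) :\ x], because
    no superset of [y |: A] is exhausted. *)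
Lemma exchange_in_family A x y :
  A \in F -> x \in A -> y \in N A -> y |: A :\ x \in F.
Proof.
move=> FA Ax NAy.
have Ay : y \notin A by rewrite (disjointFl (disjN FA)).
have not_ex P : y |: A \subset P -> ~~ exhausted P.
  rewrite subUset sub1set => /andP[Py sAP].
  apply/exists_inP=> -[A' FA' /andP[sA'P dP]].
  have [eqA|neqA] := eqVneq A' A.
    by rewrite -eqA in NAy; rewrite (disjointFr dP NAy) in Py.
  case/negP: (meetN FA' FA neqA).
  by rewrite disjoint_sym (disjointWr sAP).
have tight P : y |: A \subset P -> trace_sum P = 1.
  have [n] := ubnP #|~: P|; elim: n P => // n IHn P; rewrite ltnS => leP sP.
  have [->//|] := eqVneq P setT.
  rewrite -subTset => /subsetPn[z _ Pz].
  have sP' : y |: A \subset z |: P by rewrite (subset_trans sP) ?subsetU1.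
  have -> : P = (z |: P) :\ z by rewrite setU1K.
  apply: trace_sum_eq1D1 (setU11 _ _) _; first exact: not_ex.
  apply: IHn => //; move: leP; rewrite (cardsD1 z) inE Pz.
  by rewrite setCU setIC setDE.
have /eqP : trace_sum ((y |: A) :\ x) = 1.
  by apply: trace_sum_eq1D1; rewrite ?tight ?not_ex // inE Ax orbT.
have -> : (y |: A) :\ x = y |: A :\ x.
  rewrite setDUl; congr (_ :|: _); apply/setDidPl; rewrite disjoints1 inE.
  by apply: contraNneq Ay => ->.
have cA : #|y |: A :\ x| = p.
  by rewrite cardsU1 !inE (negbTE Ay) andbF -(cardF FA) [in RHS](cardsD1 x) Ax.
have [//|nF] := boolP (_ \in F).
rewrite /trace_sum big1 => [|A' /andP[FA' sA']].
  by rewrite eq_sym oner_eq0.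
case/negP: nF; suff <- : A' = y |: A :\ x by [].
by apply/eqP; rewrite eqEcard sA' cA (cardF FA') leqnn.
Qed.
End SetPairs.

(** If the number of set pairs reaches the Bollobas bound, exchanging a point of
    [A] with one of [N A] stays in the family and does not change [A :|: N A].
    Hence this union [X] is common to all the pairs reached from one of them,
    and the exchanges reach every p-subset of [X]. *)
Lemma tight_set_pairs (V : finType) (p q : nat) (F : {set {set V}})
    (N : {set V} -> {set V}) :
  {in F, forall A : {set V}, #|A| = p} ->
  {in F, forall A : {set V}, #|N A| = q} ->
  {in F, forall A : {set V}, [disjoint A & N A]} ->
  {in F &, forall A A' : {set V}, A != A' -> ~~ [disjoint A' & N A]} ->
  'C(p + q, p) <= #|F| ->
  exists2 X : {set V}, #|X| = p + q &
    forall B : {set V}, B \subset X -> #|B| = p -> B \in F.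
Proof.
move=> cF cN dN mN leF.
have tight : trace_sum p F N setT = 1%R.
  apply/Order.POrderTheory.le_anti/andP; split; first exact: trace_sum_le1.
  rewrite /trace_sum (eq_bigl [in F]) => [|A]; last by rewrite /= subsetT andbT.
  rewrite (eq_bigr (fun=> pair_weight p q)) => [|A FA]; last first.
    by rewrite setIT cN.
  rewrite GRing.sumr_const -[leRHS]GRing.mulr_natl /pair_weight.
  rewrite Num.Theory.ler_pdivlMr ?GRing.mul1r ?Num.Theory.ler_nat //.
  by rewrite Num.Theory.ltr0n bin_gt0 leq_addr.
have exch := exchange_in_family cF dN mN tight.
have card_pair A : A \in F -> #|A :|: N A| = p + q.
  move=> FA; rewrite cardsU (cF _ FA) (cN _ FA).
  by have := dN _ FA; rewrite -setI_eq0 => /eqP->; rewrite cards0 subn0.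
have same_union A x y : A \in F -> x \in A -> y \in N A ->
    (y |: A :\ x) :|: N (y |: A :\ x) = A :|: N A.
  move=> FA Ax Ny; set A' := y |: A :\ x.
  have FA' : A' \in F by apply: exch.
  (* If N A' had a point z outside A :|: N A, exchanging y for z in A' would
     give a member of F that is disjoint from N A but different from A. *)
  apply/eqP; rewrite eqEcard !card_pair // leqnn andbT !subUset sub1set.
  rewrite inE Ny orbT (subset_trans (subD1set _ _) (subsetUl _ _)) /=.
  apply/subsetP=> z NA'z; apply/negPn/negP; rewrite inE negb_or => /andP[Az Nz].
  have FA2 : z |: A' :\ y \in F by apply: exch => //; apply: setU11.
  have neq : A != z |: A' :\ y by apply: contraNneq Az => ->; apply: setU11.
  case/negP: (mN _ _ FA FA2 neq); rewrite -setI_eq0; apply/eqP/setP=> u.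
  rewrite !inE; apply/andP=> -[]; case: (eqVneq u z) => [->|_ /=].
    by rewrite (negbTE Nz).
  case: (eqVneq u y) => //= _ /andP[_ Au].
  by rewrite (disjointFr (dN _ FA) Au).
have [A0 FA0] : exists A, A \in F.
  by apply/set0Pn; rewrite -card_gt0 (leq_trans _ leF) // bin_gt0 leq_addr.
exists (A0 :|: N A0); first exact: card_pair.
move=> B sB cB.
have [n] := ubnP #|B :\: A0|; elim: n A0 FA0 sB => // n IHn A FA sB.
rewrite ltnS => leB.
have [BA0|[y /setDP[By Ay]]] := set_0Vmem (B :\: A).
  suff -> : B = A by [].
  by apply/eqP; rewrite eqEcard cB (cF _ FA) leqnn andbT -setD_eq0 BA0.
have Ny : y \in N A by have := subsetP sB y By; rewrite inE (negbTE Ay).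
have /subsetPn[x Ax Bx] : ~~ (A \subset B).
  apply: contraNN Ay => sAB; suff -> : A = B by [].
  by apply/eqP; rewrite eqEcard sAB cB (cF _ FA) leqnn.
apply: (IHn (y |: A :\ x)); [exact: exch | by rewrite same_union |].
apply: leq_trans leB; rewrite [leqRHS](cardsD1 y) !inE Ay By /= ltnS.
apply: subset_leq_card; apply/subsetP=> z; rewrite !inE.
case: (eqVneq z y) => //= _; case: (eqVneq z x) => [->|_] //=.
by rewrite (negbTE Bx) andbF.
Qed.

(** * Counting the r-sets that contain a given set *)

Section Supersets.
Variable V : finType.
Implicit Types (S T X Y Z M P h : {set V}).

Lemma exists_between_card S T n :
  S \subset T -> #|S| <= n <= #|T| ->
  exists Y, [/\ S \subset Y, Y \subset T & #|Y| = n].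
Proof.
move=> sST /andP[leSn]; have [d] := ubnP (n - #|S|).
elim: d S leSn sST => // d IHd S leSn sST ltd lenT.
have [eqn|neqn] := eqVneq #|S| n; first by exists S.
have ltSn : #|S| < n by rewrite ltn_neqAle neqn.
have [x Tx Sx] : exists2 x, x \in T & x \notin S.
  apply/subsetPn; apply: contraTN (leq_trans ltSn lenT); rewrite -leqNgt.
  exact: subset_leq_card.
have cxS : #|x |: S| = #|S|.+1 by rewrite cardsU1 Sx.
have [|||//|Y [sxS sYT cY]] := IHd (x |: S).
- by rewrite cxS.
- by rewrite subUset sub1set Tx.
- by rewrite cxS; lia.
by exists Y; split=> //; apply: subset_trans sxS; apply: subsetU1.
Qed.

Lemma leq_card_bigcup (I T : finType) (A : {set I}) (F : I -> {set T}) c :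
  (forall i, i \in A -> #|F i| <= c) -> #|\bigcup_(i in A) F i| <= #|A| * c.
Proof.
move=> leF; apply: (@leq_trans (\sum_(i in A) #|F i|)).
  elim/big_rec2: _ => [|i n D _ leDn]; first by rewrite cards0.
  by rewrite (leq_trans (leq_card_setU _ _)) ?leq_add2l.
by rewrite -sum_nat_const; apply: leq_sum.
Qed.

Definition supersets r P := [set h : {set V} | (#|h| == r) && (P \subset h)].

(** The case distinction gives the value 0 when [r < p], where truncated
    subtraction alone would give 1. *)
Definition n_supersets n r p := if p <= r then 'C(n - p, r - p) else 0.

Lemma card_supersets r P : #|supersets r P| = n_supersets #|V| r #|P|.
Proof.
rewrite /n_supersets; case: leqP => [lePr|ltrP]; last first.
  apply: eq_card0 => h; rewrite inE; apply: contraTF ltrP => /andP[/eqP<- sPh].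
  by rewrite -leqNgt subset_leq_card.
have -> : #|V| - #|P| = #|~: P| by rewrite [in RHS]cardsCs setCK.
rewrite -cards_draws; set D := [set _ | _].
have setUP_inj : {in D &, injective (setU P)}.
  move=> B C; rewrite !inE => /andP[sB _] /andP[sC _].
  move=> /(congr1 (fun X : {set V} => X :\: P)).
  by rewrite !setDUl setDv !set0U !(setDidPl _) // disjoints_subset.
rewrite -(card_in_imset setUP_inj).
apply/eq_card=> h; rewrite inE; apply/andP/imsetP=> [[/eqP ch sPh]|[B]].
  exists (h :\: P); last first.
    apply/setP=> x; rewrite !inE.
    by case Px: (x \in P); rewrite //= (subsetP sPh).
  by rewrite !inE setDE subsetIr -setDE cardsD (setIidPr sPh) ch eqxx.
rewrite !inE => /andP[sB /eqP cB] ->; rewrite subsetUl cardsU cB.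
have -> : P :&: B = set0.
  by apply/eqP; rewrite setI_eq0 disjoint_sym disjoints_subset.
by rewrite cards0 subn0 subnKC.
Qed.

Lemma mul_n_supersets n r p :
  (n - p) * n_supersets n r p.+1 = (r - p) * n_supersets n r p.
Proof.
rewrite /n_supersets; case: ltnP => [ltpr|lerp]; last first.
  have /eqP-> : r - p == 0 by rewrite subn_eq0.
  by rewrite muln0 mul0n.
rewrite ltnW //; have -> : r - p = (r - p.+1).+1 by lia.
by have := mul_bin_diag (n - p) (r - p.+1); rewrite -subnS.
Qed.

(** The r-sets that contain [P] together with a further vertex of a bounded set
    [Z] are of lower order than all those that contain [P]. *)
Lemma card_supersets_meet r P Z :
  #|[set h in supersets r P | ~~ [disjoint h & Z :\: P]]|
    <= #|Z| * n_supersets #|V| r #|P|.+1.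
Proof.
apply: (@leq_trans #|\bigcup_(x in Z :\: P) supersets r (x |: P)|).
  apply: subset_leq_card; apply/subsetP=> h.
  rewrite !inE -andbA => /and3P[ch sPh].
  rewrite -setI_eq0 => /set0Pn[x /setIP[hx ZPx]].
  by apply/bigcupP; exists x => //; rewrite inE ch subUset sub1set hx.
apply: leq_trans (leq_card_bigcup (c := n_supersets #|V| r #|P|.+1) _) _.
  by move=> x /setDP[_ Px]; rewrite card_supersets cardsU1 Px.
by rewrite leq_mul2r subset_leq_card ?orbT ?subsetDl.
Qed.

End Supersets.

(** * Minimum positive degree *)

Lemma lt_min_pos_degreeP (V : finType) c i (H : {set {set V}}) :
  reflect (forall S : {set V}, #|S| = i -> 0 < degree H S -> c < degree H S)
          (lt_ext c (min_pos_degree i H)).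
Proof.
rewrite /min_pos_degree; case: existsP => [exS|noS] /=; last first.
  by constructor=> S cS dS; case: noS; exists S; rewrite cS eqxx.
apply: (iffP idP) => [lt_c S cS dS|deg_gt].
  apply: leq_trans lt_c _; apply/bigmax_leqP => m /forallP/(_ S)/implyP.
  by apply; rewrite cS eqxx.
have [S0 /andP[/eqP cS0 dS0]] := exS.
have lt_cH : c.+1 < #|H|.+1.
  rewrite ltnS; apply: leq_trans (deg_gt _ cS0 dS0) _; apply: subset_leq_card.
  by apply/subsetP=> h; rewrite inE => /andP[].
apply: (bigmax_sup (Ordinal lt_cH)) => //=.
by apply/forallP=> S; apply/implyP=> /andP[/eqP cS dS]; apply: deg_gt.
Qed.

(** * Sets meeting every edge in t vertices *)

Definition tcover (V : finType) t (H : {set {set V}}) (M : {set V}) : bool :=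
  [forall h in H, t <= #|M :&: h|].

Section Covers.
Variables (V : finType) (k r s t : nat) (H : {set {set V}}).
Implicit Types (A M P R S U X Y Z h : {set V}).
Hypotheses (k_gt0 : 0 < k) (le_sk : s <= k) (le_st : s <= t) (le_tr : t <= r).
Hypotheses (Hr : Defs.rgraph r H) (Ht : t_intersecting t H).
Hypothesis Hdeg : forall S : {set V},
  #|S| = r - s -> 0 < degree H S -> 'C(k - 1, s) < degree H S.

Local Notation m := (k - s + t).

Lemma tcoverP M : reflect {in H, forall h, t <= #|M :&: h|} (tcover t H M).
Proof. exact: forall_inP. Qed.

Lemma tcover_edge h : h \in H -> tcover t H h.
Proof.
move=> Hh; apply/tcoverP=> h' Hh'; have [<-|neq] := eqVneq h h'.
  by rewrite setIid (Hr Hh).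
exact: Ht.
Qed.

(** The extensions of [h :\: A] to edges inject into s-sets, and at most
    C(k-1, s) of these lie in [Y]. *)
Lemma exchange_edge h A Y :
  h \in H -> A \subset h -> #|A| = s -> #|Y| < k ->
  exists2 h', h' \in H &
    (h :\: A \subset h') && ~~ (h' :\: (h :\: A) \subset Y).
Proof.
move=> Hh sAh cA ltY; set S := h :\: A.
have cS : #|S| = r - s by rewrite cardsD (setIidPr sAh) cA (Hr Hh).
apply/exists_inP; apply: contraT; rewrite negb_exists_in => /forall_inP noh'.
have dS : 0 < degree H S by apply/card_gt0P; exists h; rewrite inE Hh subsetDl.
have := Hdeg cS dS; rewrite ltnNge => /negP[].
have setDS_inj :
    {in [set h in H | S \subset h] &, injective (fun h => h :\: S)}.
  move=> h1 h2; rewrite !inE => /andP[_ s1] /andP[_ s2] eqD.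
  by rewrite -(setID h1 S) -(setID h2 S) eqD (setIidPr s1) (setIidPr s2).
rewrite /degree -(card_in_imset setDS_inj).
apply: (@leq_trans 'C(#|Y|, s)); last by apply: leq_bin2l; lia.
rewrite -cards_draws; apply: subset_leq_card; apply/subsetP=> B.
case/imsetP=> h'; rewrite inE => /andP[Hh' sSh'] ->; rewrite inE.
have := noh' _ Hh'; rewrite negb_and sSh' negbK /= => ->.
rewrite cardsD (setIidPr sSh') cS (Hr Hh').
by apply/eqP; rewrite subKn // (leq_trans le_st).
Qed.

(** Take [h] with the smallest trace on [M] among the edges containing [R].  If
    [M] were smaller than [#|M :&: h| + k - s], then s vertices [A] of this
    trace could be traded for s vertices not all in [M], with a smaller trace as
    result.  As [A] lies in [M], the trade does not affect [R]. *)
Lemma small_trace M R h0 :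
  tcover t H M -> h0 \in H -> R \subset h0 -> [disjoint R & M] ->
  exists2 h, h \in H & (R \subset h) && (#|M :&: h| + k <= #|M| + s).
Proof.
move=> /tcoverP covM Hh0 sRh0 dRM.
have P0 : [pred h in H | R \subset h] h0 by rewrite /= Hh0.
case: (arg_minnP (fun h : {set V} => #|M :&: h|) P0) => h /andP[Hh sRh] minh.
exists h => //; rewrite sRh /= leqNgt; apply/negP=> ltM.
have [A [_ sAMh cA]] : exists A : {set V},
    [/\ set0 \subset A, A \subset M :&: h & #|A| = s].
  apply: exists_between_card; rewrite ?sub0set // cards0.
  by rewrite (leq_trans le_st) ?covM.
have /andP[sAM sAh] : (A \subset M) && (A \subset h) by rewrite -subsetI.
have cMS : #|M :&: (h :\: A)| = #|M :&: h| - s.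
  by rewrite setIDA cardsD (setIidPr sAMh) cA.
have ltY : #|M :\: (h :\: A)| < k.
  rewrite cardsD cMS.
  move: (covM _ Hh) (subset_leq_card (subsetIl M h)) ltM le_st.
  by clear; lia.
have [h' Hh' /andP[sSh' nsY]] := exchange_edge Hh sAh cA ltY.
have sRh' : R \subset h'.
  apply: subset_trans sSh'; rewrite subsetD sRh /=.
  exact: disjointWr sAM dRM.
have := minh h'; rewrite /= Hh' sRh' leqNgt => /(_ isT)/negP[].
have -> : M :&: h' = (M :&: (h :\: A)) :|: (M :&: (h' :\: (h :\: A))).
  by rewrite -setIUr -{1}(setID h' (h :\: A)) (setIidPr sSh').
have cB : #|h' :\: (h :\: A)| = s.
  rewrite cardsD (setIidPr sSh') cardsD (setIidPr sAh) cA (Hr Hh) (Hr Hh').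
  by rewrite subKn // (leq_trans le_st).
apply: leq_ltn_trans (leq_card_setU _ _) _; rewrite cMS.
have : #|M :&: (h' :\: (h :\: A))| < s.
  rewrite -cB; apply: proper_card; rewrite properE subsetIr /=.
  apply: contra nsY; rewrite subsetI => /andP[sBM _].
  rewrite subsetD sBM /= disjoint_sym disjoints_subset subsetC.
  by rewrite setDE subsetIr.
by move: (covM _ Hh) le_st; clear; lia.
Qed.

Lemma leq_card_tcover M : H != set0 -> tcover t H M -> m <= #|M|.
Proof.
case/set0Pn=> h0 Hh0 covM.
have [||h Hh /andP[_]] := small_trace (R := set0) covM Hh0.
  exact: sub0set.
  by rewrite -setI_eq0 set0I.
by move: (tcoverP _ covM _ Hh) le_sk; clear; lia.
Qed.

(** If [M'] avoids [h :\: M], it has to contain the trace of [h] on [M], since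
    this has only [t] vertices; the same applies to every edge [h'] with the
    same part outside [M] and a trace of size [t].  Trading [A] for s vertices
    of [M] gives such [h'], and every vertex [y] of [M] can be brought in: there
    are exactly [k] candidates for the traded vertices, so that [exchange_edge]
    applies to the [k - 1] of them other than [y]. *)
Lemma tcover_disjoint_eq M M' h :
  tcover t H M -> #|M| = m -> tcover t H M' -> #|M'| = m ->
  h \in H -> #|M :&: h| = t -> [disjoint M' & h :\: M] -> M' = M.
Proof.
move=> /tcoverP covM cM /tcoverP covM' cM' Hh cMh dM'.
have sM'M h' : h' \in H -> h' :\: M \subset h :\: M -> #|M :&: h'| = t ->
    M :&: h' \subset M'.
  move=> Hh' sh' ch'; have := covM' _ Hh'; rewrite -ch'.
  have sub : M' :&: h' \subset M :&: h'.
    apply/subsetP=> x /setIP[M'x h'x]; rewrite inE h'x andbT.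
    apply/negPn/negP=> Mx.
    have : x \in h :\: M by rewrite (subsetP sh') // inE Mx.
    by rewrite (disjointFr dM' M'x).
  move=> le; rewrite -(eqP (_ : M' :&: h' == M :&: h')) ?subsetIl //.
  by rewrite eqEcard sub.
apply/esym/eqP; rewrite eqEcard cM cM' leqnn andbT; apply/subsetP=> y My.
have [hy|hy] := boolP (y \in h).
  by apply: (subsetP (sM'M _ Hh (subxx _) cMh)); rewrite inE My.
have [A [_ sAMh cA]] : exists A : {set V},
    [/\ set0 \subset A, A \subset M :&: h & #|A| = s].
  by apply: exists_between_card; rewrite ?sub0set // cards0 cMh.
have /andP[sAM sAh] : (A \subset M) && (A \subset h) by rewrite -subsetI.
have cMS : #|M :&: (h :\: A)| = t - s.
  by rewrite setIDA cardsD (setIidPr sAMh) cA cMh.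
set S := h :\: A in cMS *.
have Yy : y \in M :\: S by rewrite !inE My (negbTE hy) andbF.
have ltY : #|(M :\: S) :\ y| < k.
  have : #|M :\: S| = k.
    by rewrite cardsD cMS cM; move: le_sk le_st; clear; lia.
  by rewrite (cardsD1 y) Yy => <-.
have [h' Hh' /andP[sSh' nsY]] := exchange_edge Hh sAh cA ltY.
rewrite -/S in sSh' nsY.
have cB : #|h' :\: S| = s.
  rewrite cardsD (setIidPr sSh') cardsD (setIidPr sAh) cA (Hr Hh) (Hr Hh').
  by rewrite subKn // (leq_trans le_st).
have cMh' : #|M :&: h'| = t - s + #|M :&: (h' :\: S)|.
  rewrite -{1}(setID h' S) (setIidPr sSh') setIUr cardsU cMS.
  have -> : M :&: S :&: (M :&: (h' :\: S)) = set0.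
    apply/setP=> x; rewrite !inE.
    by case: (x \in h); case: (x \in A); rewrite /= ?andbF.
  by rewrite cards0 subn0.
have sBM : h' :\: S \subset M.
  apply/setIidPr/eqP; rewrite eqEcard subsetIr cB.
  by move: (covM _ Hh') le_st; rewrite cMh'; clear; lia.
have h'y : y \in h'.
  apply: contraNT nsY => h'y; apply/subsetP=> z zB; have := subsetP sBM z zB.
  move: zB; rewrite in_setD => /andP[Sz h'z] Mz; rewrite in_setD1 in_setD Mz Sz.
  by rewrite !andbT; apply: contraNneq h'y => <-.
apply: (subsetP (sM'M _ Hh' _ _)); last by rewrite inE My.
  apply/subsetP=> x /setDP[h'x Mx]; rewrite inE Mx /=.
  have : x \in S.
    by apply: contraNT Mx => Sx; apply: (subsetP sBM); rewrite inE Sx.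
  by case/setDP.
by rewrite cMh' (setIidPr sBM) cB subnK.
Qed.

(** The partner of [M] for the set-pair inequality.  Preserving the part of [h0]
    outside [M], which misses [U], leaves at most [m] vertices of the resulting
    edge for [U]; [t] of these are in [M], and the others, at most [k - s], form
    the partner.  It is padded to size exactly [k - s]. *)
Lemma opposite_set U M h0 :
  (forall M', tcover t H M' -> #|M'| = m -> M' \subset U) ->
  m + (k - s) <= #|V| -> tcover t H M -> #|M| = m -> h0 \in H -> h0 :&: U = M ->
  exists N : {set V}, [/\ #|N| = k - s, [disjoint M & N] &
    forall M', tcover t H M' -> #|M'| = m -> M != M' -> ~~ [disjoint M' & N]].
Proof.
move=> sU leV covM cM Hh0 eqM.
have [||h Hh /andP[sRh leMh]] := small_trace (R := h0 :\: M) covM Hh0.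
- exact: subsetDl.
- by rewrite -setI_eq0 setIC setIDA setIC -setIDA setDv setI0.
have cMh : #|M :&: h| = t.
  apply/eqP; rewrite eqn_leq (tcoverP _ covM) // andbT.
  by move: leMh le_sk; rewrite cM; clear; lia.
have sMh0 : M \subset h0 by rewrite -eqM subsetIl.
have dRU : [disjoint h0 :\: M & U].
  rewrite -setI_eq0 -eqM; apply/eqP/setP=> x; rewrite !inE.
  by case: (x \in h0); case: (x \in U).
have leN : #|(h :&: U) :\: M| <= k - s.
  have : #|h :&: U| <= #|h :\: (h0 :\: M)|.
    apply: subset_leq_card; rewrite subsetD subsetIl /=.
    by rewrite disjoint_sym (disjointWr (subsetIr _ _)).
  rewrite cardsD (setIidPr sRh) cardsD (setIidPr sMh0) (Hr Hh) (Hr Hh0) cM.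
  have leMr : m <= r by rewrite -cM -(Hr Hh0) subset_leq_card.
  rewrite [#|h :&: U :\: M|]cardsD -setIA (setIidPr (sU _ covM cM)).
  rewrite [h :&: M]setIC cMh.
  by move: leMr; clear; lia.
have [N [sN sNM cN]] : exists N : {set V},
    [/\ (h :&: U) :\: M \subset N, N \subset ~: M & #|N| = k - s].
  apply: exists_between_card; first by rewrite setDE subsetIr.
  by rewrite leN cardsCs setCK cM; move: leV; clear; lia.
exists N; split=> // [|M' covM' cM' neq].
  by rewrite disjoint_sym disjoints_subset.
apply: contra neq => dM'; rewrite eq_sym; apply/eqP.
apply: (tcover_disjoint_eq covM cM covM' cM' Hh cMh).
rewrite disjoint_sym; apply/pred0P=> x; apply/negbTE/negP.
move=> /andP[/setDP[hx Mx] M'x].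
have := disjointFr dM' M'x; rewrite (subsetP sN) // !inE Mx hx.
by rewrite (subsetP (sU _ covM' cM')).
Qed.

(** A p-set with [p < m] is not a t-cover, so some edge meets it in fewer than
    [t] vertices.  Every t-cover containing it has then a further vertex among
    the [r] vertices of that edge. *)
Lemma branching p : H != set0 -> p <= m ->
  exists2 G : {set {set V}}, #|G| <= r ^ p &
    {in G, forall P, #|P| = p} /\
    (forall M, tcover t H M -> exists2 P, P \in G & P \subset M).
Proof.
move=> H0; elim: p => [_|p IHp ltpm].
  exists [set set0]; first by rewrite cards1.
  split=> [P /set1P->|M _]; first exact: cards0.
  by exists set0; rewrite ?set11 ?sub0set.
have [G cG [cardG covG]] := IHp (ltnW ltpm).
pose miss P := odflt set0 [pick h in H | #|P :&: h| < t].
exists (\bigcup_(P in G) [set x |: P | x in miss P :\: P]).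
  apply: leq_trans (leq_card_bigcup (c := r) _) _; last first.
    by rewrite expnSr leq_mul2r cG orbT.
  move=> P _; apply: leq_trans (leq_imset_card _ _) _.
  apply: leq_trans (subset_leq_card (subsetDl _ _)) _.
  rewrite /miss; case: pickP => [h /andP[Hh _]|_] /=; first by rewrite (Hr Hh).
  by rewrite cards0.
split=> [Q /bigcupP[P GP /imsetP[x /setDP[_ Px] ->]]|M covM].
  by rewrite cardsU1 Px (cardG _ GP).
have [P GP sPM] := covG M covM.
have : ~~ tcover t H P.
  by apply: contraL ltpm => covP; rewrite -leqNgt -(cardG _ GP) leq_card_tcover.
rewrite negb_forall_in => /exists_inP[h Hh]; rewrite -ltnNge => ltPh.
have missP : (miss P \in H) && (#|P :&: miss P| < t).
  by rewrite /miss; case: pickP => [//|/(_ h)]; rewrite /= Hh ltPh.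
case/andP: missP => Hmiss ltmiss.
have /subsetPn[x /setIP[Mx mx] Px] : ~~ (M :&: miss P \subset P).
  apply: contraL ltmiss => sub; rewrite -leqNgt.
  apply: leq_trans (tcoverP _ covM _ Hmiss) _; apply: subset_leq_card.
  by rewrite subsetI sub subsetIr.
exists (x |: P); last by rewrite subUset sub1set Mx.
by apply/bigcupP; exists P => //; apply/imsetP; exists x; rewrite // inE mx Px.
Qed.

(** * Either a kernel or few edges *)

(** Every edge contains a member of the branching family [G].  Those in [F] are
    the only members that may lie in a full order of magnitude of edges: if [P]
    is not a t-cover, the edges containing it have a further vertex on some
    fixed edge, and if [P] is a t-cover outside [F], they have one in [U]. *)
Lemma kernel_or_few_edges : 0 < t -> m + (k - s) <= #|V| ->
  (exists2 X : {set V}, #|X| = m + (k - s) &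
     {in H, forall h : {set V}, m <= #|h :&: X|}) \/
  #|H| <= ('C(m + (k - s), m)).-1 * n_supersets #|V| r m
            + r ^ m * (r ^ m * m + r) * n_supersets #|V| r m.+1.
Proof.
move=> t_gt0 leV; have [->|H0] := eqVneq H set0; first by right; rewrite cards0.
have [G cG [cardG covG]] := branching H0 (leqnn m).
pose C := [set M in G | tcover t H M]; pose U := cover C.
have memC M : tcover t H M -> #|M| = m -> M \in C.
  move=> covM cM; rewrite inE covM andbT; have [P GP sPM] := covG M covM.
  suff <- : P = M by [].
  by apply/eqP; rewrite eqEcard sPM cM (cardG _ GP) leqnn.
have sU M : tcover t H M -> #|M| = m -> M \subset U.
  by move=> covM cM; apply: (bigcup_max M) => //; apply: memC.
have cU : #|U| <= r ^ m * m.
  apply: leq_trans (leq_card_bigcup (c := m) _) _.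
    by move=> M; rewrite inE => /andP[/cardG->].
  rewrite leq_mul2r (leq_trans _ cG) ?orbT // subset_leq_card //.
  by apply/subsetP=> M; rewrite inE => /andP[].
pose F := [set M in C | [exists h in H, h :&: U == M]].
have FP M : M \in F -> [/\ M \in G, tcover t H M, #|M| = m &
    exists2 h, h \in H & h :&: U = M].
  rewrite !inE => /andP[/andP[GM covM] /exists_inP[h Hh /eqP eqM]].
  by split=> //; [apply: cardG | exists h].
have [leF|ltF] := leqP 'C(m + (k - s), m) #|F|; [left|right].
  pose opp (M N : {set V}) := [&& #|N| == k - s, [disjoint M & N] &
    [forall M' : {set V}, (M' \in F) && (M != M') ==> ~~ [disjoint M' & N]]].
  pose N (M : {set V}) := odflt set0 [pick N : {set V} | opp M N].
  have oppN M : M \in F -> opp M (N M).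
    move=> /FP[_ covM cM [h Hh eqM]].
    have [N0 [cN0 dN0 mN0]] := opposite_set sU leV covM cM Hh eqM.
    rewrite /N; case: pickP => [//|/(_ N0)]; rewrite /opp cN0 dN0 eqxx /=.
    move/negbT; rewrite negb_forall => /existsP[M']; rewrite negb_imply.
    by case/andP=> /andP[/FP[_ covM' cM' _] neq]; rewrite mN0.
  have [| | | | //|X cX subX] := @tight_set_pairs _ m (k - s) F N.
  - by move=> M /FP[].
  - by move=> M /oppN/and3P[/eqP].
  - by move=> M /oppN/and3P[].
  - move=> M M' /oppN/and3P[_ _ /forallP/(_ M')/implyP mM] FM' neq.
    by apply: mM; rewrite FM'.
  exists X => // h Hh; rewrite leqNgt; apply/negP=> lt_m.
  (* An m-subset B of X that contains k - s + 1 vertices outside h meets h in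
     at most t - 1 vertices and so is no t-cover. *)
  have [D [_ sDXh cD]] : exists D : {set V},
      [/\ set0 \subset D, D \subset X :\: h & #|D| = (k - s).+1].
    apply: exists_between_card; rewrite ?sub0set // cards0 cardsD cX setIC /=.
    by move: lt_m; clear; lia.
  have [B [sDB sBX cB]] : exists B : {set V},
      [/\ D \subset B, B \subset X & #|B| = m].
    apply: exists_between_card; first exact: subset_trans sDXh (subsetDl _ _).
    by rewrite cD cX; move: t_gt0; clear; lia.
  have [_ /tcoverP/(_ h Hh) leBh _ _] := FP _ (subX B sBX cB).
  have : #|B :&: h| <= #|B :\: D|.
    apply: subset_leq_card; apply/subsetP=> x /setIP[Bx hx].
    rewrite inE Bx andbT; apply: contraL hx => Dx.
    by have := subsetP sDXh x Dx; rewrite inE => /andP[].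
  by rewrite cardsD (setIidPr sDB) cD cB; move: leBh t_gt0; clear; lia.
pose E (P : {set V}) := [set h in H | P \subset h].
have sE P : E P \subset supersets r P.
  by apply/subsetP=> h; rewrite !inE => /andP[Hh ->]; rewrite (Hr Hh) eqxx.
have HE : H \subset \bigcup_(P in F) E P :|: \bigcup_(P in G :\: F) E P.
  apply/subsetP=> h Hh; have [P GP sPh] := covG h (tcover_edge Hh).
  have [FP'|nFP] := boolP (P \in F); apply/setUP; [left|right].
    by apply/bigcupP; exists P; rewrite // inE Hh.
  by apply/bigcupP; exists P; rewrite inE ?GP ?nFP ?Hh.
apply: leq_trans (subset_leq_card HE) _; apply: leq_trans (leq_card_setU _ _) _.
apply: leq_add.
  apply: leq_trans (leq_card_bigcup (c := n_supersets #|V| r m) _) _.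
    by move=> P /FP[_ _ cP _]; rewrite -cP -card_supersets subset_leq_card.
  rewrite leq_mul2r; apply/orP; right.
  by rewrite -ltnS prednK // (leq_ltn_trans _ ltF).
rewrite -mulnA; set c := _ * n_supersets _ _ m.+1.
apply: leq_trans (leq_card_bigcup (c := c) _) _; last first.
  by rewrite leq_mul2r (leq_trans (subset_leq_card (subsetDl _ _)) cG) orbT.
move=> P /setDP[GP nFP].
have [Z leZ meetZ] : exists2 Z : {set V}, #|Z| <= r ^ m * m + r &
    forall h, h \in H -> P \subset h -> ~~ [disjoint h & Z :\: P].
  have [covP|] := boolP (tcover t H P).
    exists U => [|h Hh sPh]; first exact: leq_trans cU (leq_addr _ _).
    apply: contra nFP => dh; rewrite !inE GP covP /=.
    apply/exists_inP; exists h => //; rewrite eqEsubset [P \subset _]subsetI.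
    rewrite sPh (sU _ covP (cardG _ GP)) !andbT.
    apply/subsetP=> x /setIP[hx Ux]; apply: contraLR hx => Px.
    by rewrite (disjointFl dh) // inE Px.
  rewrite negb_forall_in => /exists_inP[g Hg]; rewrite -ltnNge => ltPg.
  exists g => [|h Hh sPh]; first by rewrite (Hr Hg) leq_addl.
  apply: contraL ltPg => dh; rewrite -leqNgt.
  apply: leq_trans (tcoverP _ (tcover_edge Hh) _ Hg) _; apply: subset_leq_card.
  apply/subsetP=> x /setIP[hx gx]; rewrite inE gx andbT.
  by apply: contraLR hx => Px; rewrite (disjointFl dh) // inE Px.
apply: (@leq_trans (#|Z| * n_supersets #|V| r m.+1)); last first.
  by rewrite leq_mul2r leZ orbT.
rewrite -(cardG _ GP); apply: leq_trans (card_supersets_meet r P Z).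
apply: subset_leq_card; apply/subsetP=> h hE; have := subsetP (sE P) h hE.
by move: hE; rewrite !inE => /andP[Hh sPh] ->; rewrite meetZ.
Qed.

End Covers.

(** * Kernel systems *)

Definition kernel_edges (V : finType) (r b : nat) (X : {set V}) :
    {set {set V}} :=
  [set h : {set V} | (#|h| == r) && (b <= #|h :&: X|)].

(** The edges whose trace on [X] has exactly [b] vertices already suffice: most
    r-sets containing a b-subset of [X] have that subset as their trace, since
    the others have a further vertex among the remaining [c] ones. *)
Lemma card_kernel_edges (V : finType) (r b c : nat) (X : {set V}) :
  #|X| = b + c ->
  'C(b + c, b) * n_supersets #|V| r b
    <= #|kernel_edges r b X| + 'C(b + c, b) * (c * n_supersets #|V| r b.+1).
Proof.
move=> cX; pose D := [set M : {set V} | M \subset X & #|M| == b].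
have cD : #|D| = 'C(b + c, b) by rewrite cards_draws cX.
pose E (M : {set V}) := [set h in kernel_edges r b X | h :&: X == M].
have sumE : \sum_(M in D) #|E M| <= #|kernel_edges r b X|.
  rewrite -[leqRHS]sum1_card.
  rewrite [leqRHS](partition_big (fun h => h :&: X) predT) //=.
  rewrite [leqRHS](bigID [in D]) /=; apply: leq_trans (leq_addr _ _).
  by apply: leq_sum => M _; rewrite sum1dep_card.
rewrite -cD -!sum_nat_const; apply: leq_trans (leq_add sumE (leqnn _)).
rewrite -big_split /=; apply: leq_sum => M; rewrite inE => /andP[sMX /eqP cM].
rewrite -cM -card_supersets.
have cXM : #|X :\: M| = c by rewrite cardsD (setIidPr sMX) cX cM addKn.
rewrite -cXM; apply: leq_trans (leq_add (leqnn _) (card_supersets_meet r M _)).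
apply: leq_trans (leq_card_setU _ _); apply: subset_leq_card.
apply/subsetP=> h; rewrite !inE => /andP[ch sMh]; rewrite ch sMh /=.
have sMhX : M \subset h :&: X by rewrite subsetI sMh.
rewrite -{1}cM subset_leq_card //= eqEsubset sMhX andbT.
case: (boolP (h :&: X \subset M)) => //= /subsetPn[x /setIP[hx Xx] Mx].
by rewrite -setI_eq0; apply/set0Pn; exists x; rewrite !inE hx Xx Mx.
Qed.

Section Kernel.
Variables (V : finType) (k r s t : nat) (X : {set V}).
Hypotheses (s_gt0 : 0 < s) (le_sk : s <= k) (le_st : s <= t).

Local Notation m := (k - s + t).

Hypotheses (le_mr : m <= r) (cX : #|X| = m + (k - s)).

(** For an (r - s)-set [S] inside an edge, choose a k-set [Y] disjoint from [S]
    that contains the remaining vertices of [X].  So few vertices of [Y] are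
    outside [X] that every s-subset of [Y] completes [S] to an edge; this gives
    C(k, s) edges. *)
Lemma kernel_admissible :
  2 * r <= #|V| -> admissible #|V| k r s t (kernel_edges r m X).
Proof.
move=> leV; split=> //.
- by move=> h; rewrite inE => /andP[/eqP].
- move=> h h'; rewrite !inE => /andP[_ leh] /andP[_ leh'] _.
  apply: (@leq_trans #|(h :&: X) :&: (h' :&: X)|); last first.
    by apply: subset_leq_card; apply: setISS; apply: subsetIl.
  have : #|(h :&: X) :|: (h' :&: X)| <= #|X|.
    by apply: subset_leq_card; rewrite subUset !subsetIr.
  by rewrite cardsU cX; move: leh leh'; clear; lia.
apply/lt_min_pos_degreeP=> S cS /card_gt0P[h]; rewrite !inE.
case/andP=> /andP[/eqP ch leh] sSh.
have leSX : m <= #|S :&: X| + s.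
  apply: leq_trans leh _; apply: (@leq_trans #|(S :&: X) :|: (h :\: S)|).
    apply: subset_leq_card; apply/subsetP=> x /setIP[hx Xx].
    by rewrite !inE hx Xx; case: (x \in S).
  apply: leq_trans (leq_card_setU _ _) _; rewrite cardsD (setIidPr sSh) ch cS.
  by move: le_mr le_st; clear; lia.
have leSX' : #|S :&: X| <= #|X| by rewrite subset_leq_card ?subsetIr.
have cXS : #|X :\: S| = m + (k - s) - #|S :&: X| by rewrite cardsD setIC cX.
have [Y [sXY sYS cY]] : exists Y : {set V},
    [/\ X :\: S \subset Y, Y \subset ~: S & #|Y| = k].
  apply: exists_between_card; first by rewrite setDE subsetIr.
  rewrite [#|~: S|]cardsCs setCK cS cXS.
  by move: leSX le_mr le_st le_sk leV; clear; lia.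
have setUS_inj : {in [set B : {set V} | B \subset Y & #|B| == s] &,
    injective (fun B : {set V} => S :|: B)}.
  move=> B B'; rewrite !inE => /andP[sB _] /andP[sB' _].
  move=> /(congr1 (fun B : {set V} => B :\: S)); rewrite !setDUl setDv !set0U.
  by rewrite !(setDidPl _) // disjoints_subset; apply: subset_trans sYS.
apply: (@leq_trans 'C(k, s)).
  case: (s) s_gt0 le_sk => // s' _; case: (k) => // k' lek.
  by rewrite subn1 binS -addn1 leq_add2l bin_gt0.
rewrite -[X in 'C(X, _)]cY -cards_draws -(card_in_imset setUS_inj).
apply: subset_leq_card; apply/subsetP=> h' /imsetP[B]; rewrite inE.
case/andP=> sBY /eqP cB ->; rewrite !inE subsetUl andbT.
have dSB : S :&: B = set0.
  apply/eqP; rewrite setI_eq0 disjoint_sym disjoints_subset.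
  exact: subset_trans sYS.
rewrite cardsU dSB cards0 subn0 cS cB.
have -> : r - s + s = r by move: le_mr le_st; clear; lia.
rewrite eqxx /= setIUl cardsU.
have -> : S :&: X :&: (B :&: X) = set0 by rewrite setIACA dSB set0I.
rewrite cards0 subn0.
have leYX : #|X :\: S| + #|Y :\: X| <= k.
  rewrite -cY -(cardsID X Y) leq_add2r subset_leq_card //.
  by rewrite subsetI sXY subsetDl.
have leB : #|B| <= #|B :&: X| + #|Y :\: X|.
  by rewrite -(cardsID X B) leq_add2l subset_leq_card // setSD.
by move: leYX leB leSX'; rewrite cXS cB cX; clear; lia.
Qed.

End Kernel.

(** * Large vertex sets *)

Lemma leq_bin_exp n m : 'C(n, m) <= 2 ^ n.
Proof.
rewrite -[n in leqLHS]card_ord -cardsT -cards_draws.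
rewrite -[n in leqRHS]card_ord -cardsT -card_powerset.
by apply: subset_leq_card; apply/subsetP=> A; rewrite !inE => /andP[].
Qed.

Lemma n_supersets_dominates n r p D :
  p <= r -> r + r * D < n -> D * n_supersets n r p.+1 < n_supersets n r p.
Proof.
move=> lepr ltn; rewrite ltnNge; apply/negP=> leD.
have pos : 0 < n_supersets n r p.
  by rewrite /n_supersets lepr bin_gt0; move: ltn; clear; lia.
have pos1 : 0 < n_supersets n r p.+1.
  by have := leq_trans pos leD; rewrite muln_gt0 => /andP[].
have : (n - p) * n_supersets n r p.+1 <= r * D * n_supersets n r p.+1.
  by rewrite mul_n_supersets -mulnA leq_mul // leq_subr.
by rewrite leq_pmul2r //; move: ltn lepr; clear; lia.
Qed.

(* A set of 2k-2s+t vertices exists only if 2k-2s+t <= n. For large n this can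
   fail only when k-s+t > r, where kernel systems have no edges. *)
Theorem theorem1p3 (r : nat) (hr : 0 < r) :
  exists n0 : nat, forall (n k s t : nat) (V : finType) (H : {set {set V}}),
    n0 <= n -> 0 < k -> 0 < s -> 0 < t -> s <= k -> s <= t -> t <= r ->
    extremal n k r s t H ->
    (2 * k - 2 * s + t <= n ->
       kernel_system r (2 * k - 2 * s + t) (k - s + t) H) /\
    (n < 2 * k - 2 * s + t -> H = set0).
Proof.
(* D bounds the sum of the coefficients of the lower order terms in
   kernel_or_few_edges and card_kernel_edges, with 2 ^ (2 * r) bounding the
   binomial coefficient. *)
pose D := 2 ^ (2 * r) * r + r ^ r * (r ^ r * r + r).
exists (2 * r + r * D).+1 => n k s t V H.
move=> le_n0 k_gt0 s_gt0 t_gt0 le_sk le_st le_tr.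
case=> -[cV Hr Ht /lt_min_pos_degreeP Hdeg] Hmax.
set m := k - s + t.
have -> : 2 * k - 2 * s + t = m + (k - s).
  by rewrite /m; move: le_sk; clear; lia.
have [ltrm|lemr] := ltnP r m.
  have -> : H = set0.
    apply/eqP; apply: contraTT ltrm => H0; rewrite -leqNgt.
    have /set0Pn[h Hh] := H0; rewrite -(Hr _ Hh).
    have covh := tcover_edge le_tr Hr Ht Hh.
    exact: (leq_card_tcover k_gt0 le_sk le_st le_tr Hr Hdeg H0 covh).
  split=> // leX; have [X [_ _ cX]] : exists X : {set V},
      [/\ set0 \subset X, X \subset setT & #|X| = m + (k - s)].
    by apply: exists_between_card; rewrite ?sub0set // cards0 cardsT cV.
  exists X => //; apply/esym/eqP; rewrite -subset0; apply/subsetP=> h.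
  rewrite inE => /andP[/eqP ch]; rewrite leqNgt.
  by rewrite (leq_ltn_trans (subset_leq_card (subsetIl _ _))) // ch.
have le_ks : k - s <= r by apply: leq_trans lemr; apply: leq_addr.
have leX : m + (k - s) <= n by move: lemr le_ks le_n0; clear; lia.
have le2r : 2 * r <= #|V| by rewrite cV; move: le_n0; clear; lia.
split=> [_|]; last by rewrite ltnNge leX.
have kernelH (X : {set V}) :
    #|X| = m + (k - s) -> #|kernel_edges r m X| <= #|H|.
  by move=> cX; apply: Hmax; rewrite -cV; apply: kernel_admissible.
have leXV : m + (k - s) <= #|V| by rewrite cV.
have [[X cX leHX]|few] :=
  kernel_or_few_edges k_gt0 le_sk le_st le_tr Hr Ht Hdeg t_gt0 leXV.
  exists X => //; apply/eqP; rewrite eqEcard kernelH // andbT.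
  by apply/subsetP=> h Hh; rewrite inE (Hr _ Hh) eqxx leHX.
have [X [_ _ cX]] : exists X : {set V},
    [/\ set0 \subset X, X \subset setT & #|X| = m + (k - s)].
  by apply: exists_between_card; rewrite ?sub0set // cards0 cardsT.
have := leq_trans (card_kernel_edges r cX)
  (leq_add (leq_trans (kernelH X cX) few) (leqnn _)).
rewrite -/m; set c := 'C(_, _).
have c_gt0 : 0 < c by rewrite bin_gt0 leq_addr.
have leD : r ^ m * (r ^ m * m + r) + c * (k - s) <= D.
  have lec : c <= 2 ^ (2 * r).
    apply: leq_trans (leq_bin_exp _ _) _; rewrite leq_exp2l //.
    by move: lemr le_ks; clear; lia.
  have ler : r ^ m <= r ^ r by apply: leq_pexp2l.
  by rewrite addnC leq_add // leq_mul // leq_add // leq_mul.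
have ltV : r + r * D < #|V| by rewrite cV; move: le_n0; clear; lia.
have := n_supersets_dominates lemr ltV; rewrite ltnNge => /negP dom.
rewrite -[c in leqLHS](prednK c_gt0) mulSn addnC.
rewrite -addnA leq_add2l mulnA -mulnDl => le0.
by case: dom; apply: leq_trans le0 _; rewrite leq_mul2r leD orbT.
Qed.
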